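(* Let $G$ be a (finite, connected) square grid graph and fix any good labeling of $G$. Then there exists a word $w$ that $12$-represents the resulting labeled graph.
   Context: The grid graph is the infinite graph on $\mathbb{Z}^2$ with vertices adjacent iff at Euclidean distance $1$. A square of an induced subgraph $H$ of it is a set of four vertices of $H$ of the form $\{(x,y),(x+1,y),(x,y+1),(x+1,y+1)\}$. A square grid graph is a finite connected induced subgraph of the grid graph in which every vertex and edge lies in some square of it. A labeled graph has distinct positive integers as vertices. A word $w$ (over positive integers) $12$-represents a labeled graph $G=(V,E)$ if the set of letters of $w$ is $V$ and for all distinct $x,y\in V$: $xy\notin E$ iff some occurrence of $\min(x,y)$ precedes some occurrence of $\max(x,y)$ in $w$. A labeling of a graph is good if it has none of the following: (i) labels $p<q<r$ whose induced subgraph has exactly the edges $pq, qr$; (ii) labels $p<q<r<s$ whose induced subgraph has exactly the edges $pr, qs$; (iii) labels $p<q<r<s$ whose induced subgraph has exactly the edges $ps, qr$. *)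

(* Defs.v *)
From mathcomp Require Import all_boot all_order all_algebra finmap.

Set Implicit Arguments.
Unset Strict Implicit.
Unset Printing Implicit Defensive.

Import Order.TTheory GRing.Theory Num.Theory.

Local Open Scope fset_scope.
Local Open Scope ring_scope.

Definition point : Type := (int * int)%type.

(* Euclidean distance 1, expressed by its square, which is an integer. *)
Definition grid_adj (u v : point) : bool :=
  (u.1 - v.1) ^+ 2 + (u.2 - v.2) ^+ 2 == 1.

(* An induced subgraph of the grid graph is given by its vertex set. *)
Definition grid_connected (G : {fset point}) : Prop :=
  forall u v, u \in G -> v \in G ->
    exists p : seq point,
      [/\ {subset p <= G}, path grid_adj u p & last u p = v].

Definition is_square (G S : {fset point}) : Prop :=
  exists x y : int,
    S = [fset (x, y); (x + 1, y); (x, y + 1); (x + 1, y + 1)] /\ S `<=` G.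

Definition square_grid_graph (G : {fset point}) : Prop :=
  [/\ grid_connected G,
      forall u, u \in G -> exists2 S, is_square G S & u \in S
    & forall u v, u \in G -> v \in G -> grid_adj u v ->
        exists S, [/\ is_square G S, u \in S & v \in S]].

(* [lab] is only relevant on [G]. *)
Definition is_labeling (G : {fset point}) (lab : point -> nat) : Prop :=
  {in G &, injective lab} /\ {in G, forall u, (0 < lab u)%N}.

Definition label_set (G : {fset point}) (lab : point -> nat) : {fset nat} :=
  [fset lab u | u in G].

Definition label_edge (G : {fset point}) (lab : point -> nat) (a b : nat)
    : Prop :=
  exists u v, [/\ u \in G, v \in G, grid_adj u v, lab u = a & lab v = b].

Local Close Scope ring_scope.

(* In the next two definitions a labeled graph is given by its finite set [V]
   of labels and a symmetric edge relation [E] on [V]. *)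
Definition good_labeling (V : {fset nat}) (E : nat -> nat -> Prop) : Prop :=
  [/\ forall p q r, p \in V -> q \in V -> r \in V -> p < q < r ->
        ~ [/\ E p q, E q r & ~ E p r],
      forall p q r s, p \in V -> q \in V -> r \in V -> s \in V ->
        p < q < r -> r < s ->
        ~ ((E p r /\ E q s) /\ [/\ ~ E p q, ~ E p s, ~ E q r & ~ E r s])
    & forall p q r s, p \in V -> q \in V -> r \in V -> s \in V ->
        p < q < r -> r < s ->
        ~ ((E p s /\ E q r) /\ [/\ ~ E p q, ~ E p r, ~ E q s & ~ E r s])].

Definition occurs_before (w : seq nat) (a b : nat) : Prop :=
  exists i j, [/\ i < j, j < size w, nth 0 w i = a & nth 0 w j = b].

Definition represents12 (w : seq nat) (V : {fset nat})
    (E : nat -> nat -> Prop) : Prop :=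
  w =i V /\
  forall x y, x \in V -> y \in V -> x <> y ->
    (~ E x y <-> occurs_before w (minn x y) (maxn x y)).

(* Main.v *)
Require Import Defs.
From mathcomp Require Import all_boot all_order all_algebra finmap.
From mathcomp Require Import zify.

(** Let each letter [x] occur twice, first at time [start x] and last at time
    [finish x].  The word represents the graph iff [start x < finish y] whenever
    [x <= y] is not an edge, and [finish y <= start x] whenever [x < y] is an
    edge.  Eliminating the finishes leaves a relation on the letters: [x] is
    forced to start before [x'] when [start x < finish y <= start x'] for some
    [y].  The three forbidden patterns say exactly that this relation is
    asymmetric, and asymmetry already makes it transitive; so the number of
    predecessors can serve as [start]. *)

Set Implicit Arguments.
Unset Strict Implicit.
Unset Printing Implicit Defensive.

Section SortedWord.

Variables (T : eqType) (key letter : T -> nat) (s : seq T).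
Hypothesis s_sorted : sorted (relpre key leq) s.

Let le_key_trans : transitive (relpre key leq).
Proof. by move=> q p r; apply: leq_trans. Qed.

Let le_key_refl : reflexive (relpre key leq).
Proof. by move=> p; apply: leqnn. Qed.

Lemma key_lt_occurs_before p q :
  p \in s -> q \in s -> key p < key q ->
  occurs_before [seq letter o | o <- s] (letter p) (letter q).
Proof.
move=> ps qs key_pq; exists (index p s), (index q s).
rewrite size_map !(nth_map p) ?index_mem // !nth_index //; split=> //.
rewrite ltnNge; apply: contraL key_pq => index_qp; rewrite -leqNgt.
exact: (sorted_leq_index le_key_trans le_key_refl s_sorted).
Qed.

Lemma occurs_before_key_le a b :
  occurs_before [seq letter o | o <- s] a b ->
  exists p q, [/\ p \in s, q \in s, letter p = a, letter q = b
                & key p <= key q].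
Proof.
move=> [i [j [ij]]]; rewrite size_map => js.
have p0 : T by case: (s) js => [|p].
have lt_is := ltn_trans ij js; rewrite !(nth_map p0) // => <- <-.
exists (nth p0 s i), (nth p0 s j); split; rewrite ?mem_nth //.
exact: (sorted_leq_nth le_key_trans le_key_refl) (ltnW ij).
Qed.

End SortedWord.

Section IntervalWord.

Variables (V : {fset nat}) (start finish : nat -> nat).

(* [(x, false)] is the first occurrence of [x] and [(x, true)] the last one.
   Parity makes a finish precede every start with the same value. *)
Definition occurrence_time (o : nat * bool) : nat :=
  if o.2 then (finish o.1).*2 else (start o.1).*2.+1.

Lemma exists_interval_word :
  {in V, forall x, start x < finish x} ->
  exists2 w, w =i V &
    {in V &, forall x y, occurs_before w x y <-> start x < finish y}.
Proof.
move=> start_finish.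
pose s := sort (relpre occurrence_time leq)
               [seq (x, b) | x <- V, b <- [:: false; true]].
have s_sorted : sorted (relpre occurrence_time leq) s.
  by apply: sort_sorted => p q; apply: leq_total.
have mem_s x b : ((x, b) \in s) = (x \in V).
  rewrite mem_sort; apply/allpairsP/idP => [[[y c] [yV _ [-> _]]] //|xV].
  by exists (x, b); split=> //; case: b.
exists [seq o.1 | o <- s] => [x|x y xV yV].
  apply/mapP/idP => [[[y b] ys ->]|xV]; first by rewrite -(mem_s y b).
  by exists (x, true); rewrite ?mem_s.
split=> [|xy].
  have lt_x := start_finish _ xV; have lt_y := start_finish _ yV.
  move=> /(occurs_before_key_le s_sorted)[[x' b] [[y' c] [_ _ /= -> ->]]].
  by rewrite /occurrence_time; case: b c => [] [] /=; lia.
apply: (@key_lt_occurs_before _ _ fst _ s_sorted (x, false) (y, true)).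
- by rewrite mem_s.
- by rewrite mem_s.
- by rewrite /occurrence_time /=; lia.
Qed.

End IntervalWord.

Definition predecessors (T : choiceType) (A : {fset T}) (r : rel T) (x : T) :
    {fset T} :=
  [fset z in A | r z x]%fset.

Lemma card_predecessors_lt (T : choiceType) (A : {fset T}) (r : rel T) :
  {in A, irreflexive r} -> {in A & &, transitive r} ->
  {in A &, forall x y,
    r x y -> #|` predecessors A r x| < #|` predecessors A r y|}.
Proof.
move=> r_irr r_trans x y xA yA rxy; apply/fproper_ltn_card/andP; split.
  apply/fsubsetP => z; rewrite !inE /= => /andP[zA rzx].
  by rewrite zA (r_trans x).
by apply/fsubsetPn; exists x; rewrite !inE xA //= r_irr.
Qed.

Section GoodLabeling.

Variables (V : {fset nat}) (E : nat -> nat -> Prop) (e : rel nat).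
Hypothesis eP : forall x y, reflect (E x y) (e x y).
Hypothesis good : good_labeling V E.

Lemma good_labeling_ascending_trans :
  {in V & &, forall p q r, p < q < r -> e p q -> e q r -> e p r}.
Proof.
move=> p q r pV qV rV pqr /eP Epq /eP Eqr; apply/negPn/negP => /eP nEpr.
by case: good => no_path _ _; apply: (no_path p q r).
Qed.

Lemma good_labeling_2K2_free p q r s :
  p \in V -> q \in V -> r \in V -> s \in V ->
  p < q -> q < r -> q < s -> e p r -> e q s -> e p s || e q r.
Proof.
move=> pV qV rV sV pq qr qs epr eqs; apply/negPn/negP.
rewrite negb_or => /andP[neps neqr].
have asc_trans := good_labeling_ascending_trans.
have nepq : ~~ e p q.
  by apply: contra neps => epq; apply: (asc_trans p q s) => //; lia.
case: (good) => _ no_crossing no_nesting; case: (ltngtP r s) => [rs|sr|eq_rs].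
- have ners : ~~ e r s.
    by apply: contra neps => ers; apply: (asc_trans p r s) => //; lia.
  apply: (no_crossing p q r s) => //; first lia.
  by split; split; apply/eP.
- have nesr : ~~ e s r.
    by apply: contra neqr => esr; apply: (asc_trans q s r) => //; lia.
  apply: (no_nesting p q s r) => //; first lia.
  by split; split; apply/eP.
- by rewrite -eq_rs epr in neps.
Qed.

Definition ascending_edge (x y : nat) : bool := (x < y) && e x y.

Definition ascending_nonedge (x y : nat) : bool :=
  (x <= y) && ~~ ascending_edge x y.

Definition forced_before (x x' : nat) : bool :=
  has (fun y => ascending_nonedge x y && ascending_edge x' y) V.

Lemma forced_beforeP x x' :
  reflect (exists y, [/\ y \in V, ascending_nonedge x y & ascending_edge x' y])
          (forced_before x x').
Proof.
apply: (iffP hasP) => [[y yV /andP[nxy ex'y]]|[y [yV nxy ex'y]]].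
  by exists y.
by exists y => //; rewrite nxy.
Qed.

Lemma forced_before_asym :
  {in V &, forall x x', forced_before x x' -> ~~ forced_before x' x}.
Proof.
move=> x x' xV x'V fxx'; apply/negP => fx'x.
wlog lt_xx' : x x' xV x'V fxx' fx'x / x < x'.
  move=> wlog_lt; have [/wlog_lt|/wlog_lt|eq_xx'] := ltngtP x x'; [exact..|].
  case/forced_beforeP: fxx' => y [_ /andP[_ /negP]].
  by rewrite eq_xx'.
have /forced_beforeP[y [yV /andP[_ nxy] /andP[lt_x'y ex'y]]] := fxx'.
have /forced_beforeP[y' [y'V /andP[le_x'y' nx'y'] /andP[_ exy']]] := fx'x.
have {}nxy : ~~ e x y by move: nxy; rewrite /ascending_edge (ltn_trans lt_xx').
have [eq_x'y'|ne_x'y'] := eqVneq x' y'.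
  move/negP: nxy; apply; apply: (good_labeling_ascending_trans xV x'V yV) => //.
    by rewrite lt_xx'.
  by rewrite eq_x'y'.
have lt_x'y' : x' < y' by rewrite ltn_neqAle ne_x'y'.
have := good_labeling_2K2_free xV x'V y'V yV lt_xx' lt_x'y' lt_x'y exy' ex'y.
by move: nx'y'; rewrite /ascending_edge lt_x'y' (negbTE nxy) /= => /negbTE->.
Qed.

Lemma forced_before_irr : {in V, irreflexive forced_before}.
Proof.
move=> x xV; apply/negP => fxx.
by have := forced_before_asym xV xV fxx; rewrite fxx.
Qed.

Lemma forced_before_trans : {in V & &, transitive forced_before}.
Proof.
move=> x' x x'' x'V xV x''V fxx' fx'x''.
have /forced_beforeP[y [yV nxy ex'y]] := fxx'.
have /forced_beforeP[y' [y'V nx'y' ex''y']] := fx'x''.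
have [le_xy'|lt_y'x] := leqP x y'.
  apply/forced_beforeP; exists y'; split=> //.
  rewrite /ascending_nonedge le_xy'.
  apply: contra (forced_before_asym xV x'V fxx') => exy'.
  by apply/forced_beforeP; exists y'.
have le_x''y : x'' <= y by case/andP: nxy; case/andP: ex''y'; lia.
apply/forced_beforeP; exists y; split=> //.
apply: contraR (forced_before_asym x'V x''V fx'x'') => nx''y.
apply/forced_beforeP; exists y; split=> //.
by rewrite /ascending_nonedge le_x''y.
Qed.

Definition start_rank (x : nat) : nat := #|` predecessors V forced_before x|.

Definition finish_rank (y : nat) : nat :=
  \max_(x <- V | ascending_nonedge x y) (start_rank x).+1.

Lemma start_rank_lt_finish_rank x y :
  x \in V -> ascending_nonedge x y -> start_rank x < finish_rank y.
Proof. by move=> xV; apply: (@leq_bigmax_seq _ _ _ (fun z => _.+1) x). Qed.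

Lemma finish_rank_le_start_rank :
  {in V &, forall x y, ascending_edge x y -> finish_rank y <= start_rank x}.
Proof.
move=> x y xV yV exy; apply/bigmax_leqP_seq => z zV nzy.
apply: (card_predecessors_lt forced_before_irr forced_before_trans) => //.
by apply/forced_beforeP; exists y.
Qed.

Lemma start_rank_lt_finish_rankE :
  {in V &, forall x y,
    x <= y -> (start_rank x < finish_rank y) = ~~ ascending_edge x y}.
Proof.
move=> x y xV yV le_xy; apply/idP/idP => [|nexy].
  by apply: contraL => exy; rewrite -leqNgt finish_rank_le_start_rank.
by rewrite start_rank_lt_finish_rank // /ascending_nonedge le_xy.
Qed.

Theorem good_labeling_represents12 :
  (forall x y, E x y -> E y x) -> exists w, represents12 w V E.
Proof.
move=> E_sym.
have [|w mem_w w_before] := @exists_interval_word V start_rank finish_rank.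
  by move=> x xV; rewrite start_rank_lt_finish_rankE // /ascending_edge ltnn.
exists w; split=> // x y xV yV /eqP ne_xy.
wlog lt_xy : x y xV yV ne_xy / x < y.
  move=> wlog_lt; have := ne_xy; rewrite neq_ltn => /orP[|lt_yx].
    exact: wlog_lt.
  rewrite minnC maxnC -wlog_lt 1?eq_sym //.
  by split=> nE /E_sym.
rewrite (minn_idPl (ltnW lt_xy)) (maxn_idPr (ltnW lt_xy)).
rewrite w_before // start_rank_lt_finish_rankE ?(ltnW lt_xy) //.
by rewrite /ascending_edge lt_xy; split=> /eP.
Qed.

End GoodLabeling.

Lemma grid_adjC : symmetric grid_adj.
Proof.
move=> u v; rewrite /grid_adj -[(u.1 - v.1)%R]GRing.opprB.
by rewrite -[(u.2 - v.2)%R]GRing.opprB !GRing.sqrrN.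
Qed.

Section LabelEdge.

Variables (G : {fset point}) (lab : point -> nat).

Definition label_edgeb (a b : nat) : bool :=
  has (fun u => has (fun v => [&& grid_adj u v, lab u == a & lab v == b]) G) G.

Lemma label_edgeP a b : reflect (label_edge G lab a b) (label_edgeb a b).
Proof.
apply: (iffP hasP) => [[u uG /hasP[v vG /and3P[uv /eqP lab_u /eqP lab_v]]]|].
  by exists u, v.
move=> [u [v [uG vG uv lab_u lab_v]]].
exists u => //; apply/hasP; exists v => //.
by rewrite uv lab_u lab_v !eqxx.
Qed.

Lemma label_edge_sym a b : label_edge G lab a b -> label_edge G lab b a.
Proof.
by move=> [u [v [uG vG uv lab_u lab_v]]]; exists v, u; rewrite grid_adjC.
Qed.

End LabelEdge.

Theorem theorem21 (G : {fset point}) (lab : point -> nat)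
    (hG : square_grid_graph G) (hlab : is_labeling G lab)
    (hgood : good_labeling (label_set G lab) (label_edge G lab)) :
  exists w : seq nat, represents12 w (label_set G lab) (label_edge G lab).
Proof.
apply: (good_labeling_represents12 (label_edgeP G lab) hgood).
exact: label_edge_sym.
Qed.
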